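(* Let $u,v,w\in S_+$. Then $$\sum_{i:\ s_iu<u} i\,c_{s_iu,v}^w+\sum_{j:\ s_jv<v} j\,c_{u,s_jv}^w=\sum_{k:\ s_kw>w}k\,c_{u,v}^{s_kw},$$ where $i,j,k$ range over positive integers.
   Context: $S_+$ is the group of permutations of $\{1,2,3,\dots\}$ fixing all but finitely many elements; $s_i$ is the transposition of $i$ and $i+1$; $<$ is (strong) Bruhat order, so $s_iu<u$ means $u^{-1}(i)>u^{-1}(i+1)$. Schubert polynomials $\mathfrak S_w$, $w\in S_+$, are defined by $\mathfrak S_{w_0^{(n)}}=x_1^{n-1}x_2^{n-2}\cdots x_n^0$ for $w_0^{(n)}=n(n-1)\cdots1$ and $\mathfrak S_{ws_i}=\dfrac{\mathfrak S_w-s_i\cdot\mathfrak S_w}{x_i-x_{i+1}}$ whenever $ws_i<w$ (with $s_i$ swapping the variables $x_i,x_{i+1}$). They form a $\mathbb Z$-basis of $\mathbb Z[x_1,x_2,\dots]$, and the Schubert structure coefficients $c_{u,v}^w$ are defined by $\mathfrak S_u\cdot\mathfrak S_v=\sum_{w\in S_+}c_{u,v}^w\mathfrak S_w$. *)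

(* Defs.v *)
From HB Require Import structures.
From mathcomp Require Import all_boot all_order all_algebra finmap.
From mathcomp.multinomials Require Import monalg.
From mathcomp Require Import boolp classical_sets functions cardinality fsbigop.

Set Implicit Arguments.
Unset Strict Implicit.
Unset Printing Implicit Defensive.

Import GRing.Theory.

Local Open Scope classical_set_scope.
Local Open Scope ring_scope.

(* Indices are shifted by one: the positive integer k is encoded by k.-1 : nat.
   Thus S_+ acts on nat, [sgen i] is the paper's s_(i+1), ['x_i] its x_(i+1), and a
   weight i in the paper becomes i.+1. *)

Record splus := Splus {
  splus_fun :> nat -> nat;
  splus_inv : nat -> nat;
  splus_funK : cancel splus_fun splus_inv;
  splus_invK : cancel splus_inv splus_fun;
  splus_fin : exists n, forall k, (n <= k)%N -> splus_fun k = k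
}.

HB.instance Definition _ := gen_eqMixin splus.
HB.instance Definition _ := gen_choiceMixin splus.

Lemma splusP (u v : splus) : u =1 v -> u = v.
Proof.
case: u v => [f f' fK f'K ff] [g g' gK g'K gf] /= /funext efg; subst g.
have efg' : f' = g' by apply/funext => k; rewrite -{1}(g'K k) fK.
subst g'; congr Splus; exact: Prop_irrelevance.
Qed.

Definition splus_one : splus.
Proof. by apply: (@Splus id id) => //; exists 0%N. Defined.

Definition splus_mul (u v : splus) : splus.
Proof.
apply: (@Splus (u \o v) (splus_inv v \o splus_inv u)).
- exact: can_comp (@splus_funK u) (@splus_funK v).
- exact: can_comp (@splus_invK v) (@splus_invK u).
- case: (splus_fin u) (splus_fin v) => [m um] [n vn]; exists (maxn m n) => k.
  by rewrite geq_max => /andP[/um ku /vn kv] /=; rewrite kv.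
Defined.

Definition splus_opp (u : splus) : splus.
Proof.
apply: (@Splus (splus_inv u) u); [exact: splus_invK|exact: splus_funK|].
by case: (splus_fin u) => n un; exists n => k /un {1}<-; rewrite splus_funK.
Defined.

Fact splus_mulA : associative splus_mul.
Proof. by move=> u v w; apply: splusP. Qed.
Fact splus_mul1 : left_id splus_one splus_mul.
Proof. by move=> u; apply: splusP. Qed.
Fact splus_mulr1 : right_id splus_one splus_mul.
Proof. by move=> u; apply: splusP. Qed.
Fact splus_mulV : left_inverse splus_one splus_opp splus_mul.
Proof. by move=> u; apply: splusP => k /=; rewrite splus_funK. Qed.
Fact splus_mulrV : right_inverse splus_one splus_opp splus_mul.
Proof. by move=> u; apply: splusP => k /=; rewrite splus_invK. Qed.

HB.instance Definition _ := isGroup.Build splus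
  splus_mulA splus_mul1 splus_mulr1 splus_mulV splus_mulrV.

(* (u * v)%g is composition, v acting first. *)
Lemma splusM (u v : splus) k : (u * v)%g k = u (v k).
Proof. by []. Qed.

Definition swapn (a b k : nat) : nat :=
  if k == a then b else if k == b then a else k.

Fact swapnK a b : involutive (swapn a b).
Proof.
move=> k; rewrite /swapn; case: (eqVneq k a) => [->|ka].
  by rewrite eqxx; case: eqVneq.
case: (eqVneq k b) => [->|kb]; first by rewrite eqxx.
by rewrite (negPf ka) (negPf kb).
Qed.

Fact swapn_fin a b : exists n, forall k, (n <= k)%N -> swapn a b k = k.
Proof.
exists (maxn a b).+1 => k; rewrite gtn_max /swapn => /andP[ak bk].
by rewrite !gtn_eqF.
Qed.

Definition transp (a b : nat) : splus :=
  Splus (swapnK a b) (swapnK a b) (swapn_fin a b).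

Definition sgen (i : nat) : splus := transp i i.+1.

Definition revn (n k : nat) : nat := if (k < n)%N then (n.-1 - k)%N else k.

Fact revnK n : involutive (revn n).
Proof.
case: n => [|n] k; rewrite /revn //=.
case: (ltnP k n.+1) => [kn|nk]; last by rewrite ltnNge nk.
by rewrite ltnS leq_subr subKn.
Qed.

Fact revn_fin n : exists m, forall k, (m <= k)%N -> revn n k = k.
Proof. by exists n => k nk; rewrite /revn ltnNge nk. Qed.

Definition w0 (n : nat) : splus := Splus (revnK n) (revnK n) (revn_fin n).

(* Strong Bruhat order: right multiplication of v by (a b) increases the number
   of inversions exactly when, for a < b, v a < v b. *)
Inductive bruhat_lt (u : splus) : splus -> Prop :=
| Bruhat_step (a b : nat) :
    (a < b)%N -> (u a < u b)%N -> bruhat_lt u (u * transp a b)%g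
| Bruhat_trans (v : splus) (a b : nat) :
    bruhat_lt u v -> (a < b)%N -> (v a < v b)%N ->
    bruhat_lt u (v * transp a b)%g.

Notation "u <B v" := (bruhat_lt u v) (at level 70, no associativity).

Lemma bruhat_lt_trans (u v w : splus) : u <B v -> v <B w -> u <B w.
Proof.
by move=> uv; elim=> [a b ab vab|x a b _ IH ab xab];
  [exact: Bruhat_trans uv ab vab | exact: Bruhat_trans IH ab xab].
Qed.

Lemma bruhat_lt_lex (u v : splus) : u <B v ->
  exists a, (forall k, (k < a)%N -> v k = u k) /\ (u a < v a)%N.
Proof.
have step (x : splus) a b : (a < b)%N -> (x a < x b)%N ->
    (forall k, (k < a)%N -> (x * transp a b)%g k = x k) /\
    (x a < (x * transp a b)%g a)%N.
  move=> ab xab; split=> [k ka|]; rewrite splusM /= /swapn ?eqxx //.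
  by rewrite !ltn_eqF // (ltn_trans ka ab).
elim=> [a b ab uab|{}v a b _ [d [vu ud]] ab /(step _ _ _ ab)[xv vx]].
  by exists a; apply: step.
have [ad|da|ad] := ltngtP a d.
- exists a; split=> [k ka|]; last by rewrite -(vu _ ad).
  by rewrite xv // vu // (ltn_trans ka ad).
- exists d; split=> [k kd|]; last by rewrite xv.
  by rewrite xv ?vu // (ltn_trans kd da).
- exists a; split=> [k ka|]; first by rewrite xv // vu // -ad.
  by rewrite (ltn_trans _ vx) // ad.
Qed.

Lemma bruhat_lt_irr (u : splus) : ~ (u <B u).
Proof. by case/bruhat_lt_lex => a [_]; rewrite ltnn. Qed.

Lemma bruhat_lt_sgen (i : nat) (u : splus) :
  (u^-1%g i < u^-1%g i.+1)%N -> u <B (sgen i * u)%g.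
Proof.
move=> ab; have -> : (sgen i * u)%g = (u * transp (u^-1%g i) (u^-1%g i.+1))%g.
  apply: splusP => k; rewrite !splusM /= /swapn.
  rewrite -!(can2_eq (splus_funK u) (splus_invK u)).
  by case: eqP => _; [|case: eqP => _]; rewrite ?splus_invK.
by apply: Bruhat_step => //=; rewrite !splus_invK.
Qed.

Lemma sgen_bruhat_lt (i : nat) (u : splus) :
  (sgen i * u)%g <B u <-> (u^-1%g i.+1 < u^-1%g i)%N.
Proof.
have sV : (sgen i * (sgen i * u))%g = u.
  by apply: splusP => k; rewrite !splusM /= swapnK.
have sE k : (sgen i * u)^-1%g k = u^-1%g (swapn i i.+1 k) by [].
split=> [su|ui].
  have := ltngtP (u^-1%g i.+1) (u^-1%g i); case=> // [/bruhat_lt_sgen us|].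
    by case: (bruhat_lt_irr (bruhat_lt_trans su us)).
  by move/(can_inj (splus_invK u))/eqP; rewrite gtn_eqF.
have := @bruhat_lt_sgen i (sgen i * u)%g; rewrite sV; apply.
by rewrite !sE /swapn eqxx gtn_eqF // eqxx.
Qed.

(* Z[x_1, x_2, ...], as the monoid algebra of finitely supported exponents. *)
Notation zpoly := {malg int[{cmonom nat}]}.

Definition xvar (i : nat) : zpoly := << ucm i >>.
Notation "''x_' i" := (xvar i) (at level 8, i at level 2, format "''x_' i").

(* u . p = p (x_(u 0), x_(u 1), ...) *)
Definition pact (u : splus) (p : zpoly) : zpoly :=
  mmap (@malgC {cmonom nat} int)
       (fun m : {cmonom nat} => \prod_(i <- finsupp m) 'x_(u i) ^+ m i) p.

(* The quotient defining S_(w s_i) is expressed by clearing the denominator: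
   Z[x] is an integral domain, so this determines S_(w s_i). *)
Definition schubert_family (Sch : splus -> zpoly) : Prop :=
  (forall n, Sch (w0 n) = \prod_(i < n) 'x_i ^+ (n.-1 - i)) /\
  (forall w i, (w * sgen i)%g <B w ->
     ('x_i - 'x_i.+1) * Sch (w * sgen i)%g = Sch w - pact (sgen i) (Sch w)).

(* The second clause is a finite sum by the first one; a sum over an infinite
   support would be 0 by convention. *)
Definition structure_coefs (Sch : splus -> zpoly)
    (c : splus -> splus -> splus -> int) : Prop :=
  forall u v,
    finite_set [set w | c u v w != 0] /\
    Sch u * Sch v = \sum_(w \in [set: splus]) c u v w *: Sch w.

(* Main.v *)
Require Import Defs.
From HB Require Import structures.
From mathcomp Require Import all_boot all_order all_algebra finmap.
From mathcomp Require Import ring zify.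
From mathcomp.multinomials Require Import monalg.
From mathcomp Require Import boolp classical_sets functions cardinality fsbigop.

(** Let nabla be the derivation of Z[x_1, x_2, ...] with nabla x_i = 1 for all i,
i.e. the sum of all partial derivatives.  The identity is the Leibniz rule for
nabla on S_u * S_v, read in the basis of Schubert polynomials, once one knows

  nabla S_w = sum over k with s_k w < w of k * S_(s_k w)   ([nabla_schubert]).

On the left-hand side nabla hits S_u or S_v, and each product S_(s_i u) * S_v or
S_u * S_(s_j v) is expanded with structure coefficients.  On the right-hand side
nabla hits every S_x in the expansion of S_u * S_v; the coefficient of S_w
collects the x of the form s_k w with w < s_k w.

The formula for nabla S_w is proved along the recursion that defines Schubert
polynomials.  For w = w_0 both sides are explicit monomials
([staircase_derivation], [schubert_w0_sgen]).  It then descends from w to w s_i,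
because nabla kills x_i - x_(i+1) and commutes with permutations of the variables,
hence commutes with divided differences ([ddiff_nabla]); what remains is the
comparison of the left descents of w and w s_i ([ldesc_rdesc]).

Comparing coefficients needs the linear independence of Schubert polynomials
([schubert_free]).  A divided difference applied to a linear relation keeps only
the terms with a descent at i and makes them shorter, so induction kills every
coefficient except that of the identity, and S_1 = 1. *)

Set Implicit Arguments.
Unset Strict Implicit.
Unset Printing Implicit Defensive.

Import GRing.Theory.

Local Open Scope classical_set_scope.
Local Open Scope ring_scope.

(** * Descents of permutations *)

(** Descents are boolean so that the sums over them range over ordinals; the link
with the Bruhat order is made by [ldescP], [ldesc_sgenP] and [rdescP]. *)
Definition rdesc (i : nat) (w : splus) : bool := (w i.+1 < w i)%N.
Definition ldesc (i : nat) (w : splus) : bool := (w^-1%g i.+1 < w^-1%g i)%N.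
Definition fixes (n : nat) (w : splus) : Prop := forall k, (n <= k)%N -> w k = k.

Lemma sgenK i : cancel (splus_mul (sgen i)) (splus_mul (sgen i)).
Proof. by move=> u; apply: splusP => k; rewrite /= swapnK. Qed.

Lemma mulgsgenK i (w : splus) : (w * sgen i * sgen i)%g = w.
Proof. by apply: splusP => k; rewrite !splusM /= swapnK. Qed.

Lemma splus_invE (w : splus) k : w^-1%g k = splus_inv w k.
Proof. by []. Qed.

Lemma rdesc_sgen i w : rdesc i (w * sgen i)%g = ~~ rdesc i w.
Proof.
rewrite /rdesc !splusM /= /swapn eqxx gtn_eqF // eqxx -leqNgt [RHS]leq_eqVlt.
by rewrite (can_eq (@splus_funK w)) ltn_eqF.
Qed.

Lemma ldescP i w : (sgen i * w)%g <B w <-> ldesc i w.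
Proof. exact: sgen_bruhat_lt. Qed.

Lemma ldesc_sgenP i w : w <B (sgen i * w)%g <-> ldesc i (sgen i * w)%g.
Proof. by rewrite -ldescP -[X in X <B _ <-> _](sgenK i w). Qed.

Lemma rdescP i w : (w * sgen i)%g <B w <-> rdesc i w.
Proof.
have up (x : splus) : ~~ rdesc i x -> x <B (x * sgen i)%g.
  rewrite -rdesc_sgen /rdesc !splusM /= /swapn eqxx gtn_eqF // eqxx => lt.
  exact: Bruhat_step.
split=> [lt|d]; last first.
  by rewrite -{2}(mulgsgenK i w); apply: up; rewrite rdesc_sgen d.
by apply/negPn/negP => /up /(bruhat_lt_trans lt) /bruhat_lt_irr.
Qed.

(** Exchanging two adjacent values preserves the order of every pair other than
that pair of values itself. *)
Lemma swapn_lt k x y : (x, y) <> (k, k.+1) -> (x, y) <> (k.+1, k) ->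
  (swapn k k.+1 x < swapn k k.+1 y)%N = (x < y)%N.
Proof.
move=> n1 n2; rewrite /swapn.
have h1 : ~ (x = k /\ y = k.+1) by case=> ? ?; apply: n1; congr pair.
have h2 : ~ (x = k.+1 /\ y = k) by case=> ? ?; apply: n2; congr pair.
by do ![case: ifP]; lia.
Qed.

(** The combinatorial core of the descent from w to w s_i.  If s_k w = w s_i, then
both sides are false: s_k w has no descent at i, and w s_i < s_k w s_i = w.
Otherwise multiplication by s_k on the left does not affect the right descent at
i, and multiplication by s_i on the right does not affect the left descent at
k. *)
Lemma ldesc_rdesc i k w : rdesc i w ->
  ldesc k w && rdesc i (sgen k * w)%g = ldesc k (w * sgen i)%g.
Proof.
rewrite /rdesc /ldesc !splusM !splus_invE /= => dw.
(* The first case is s_k w = w s_i, given that w i.+1 < w i. *)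
have [[ak bk]|nak] := pselect (w i = k.+1 /\ w i.+1 = k).
  have -> : splus_inv w k = i.+1 by rewrite -bk splus_funK.
  have -> : splus_inv w k.+1 = i by rewrite -ak splus_funK.
  by rewrite ak bk /swapn; do ![case: ifP]; lia.
have pi1 : splus_inv w k.+1 = i -> w i = k.+1 by move <-; rewrite splus_invK.
have pi2 : splus_inv w k = i -> w i = k by move <-; rewrite splus_invK.
have qi1 : splus_inv w k.+1 = i.+1 -> w i.+1 = k.+1.
  by move <-; rewrite splus_invK.
have qi2 : splus_inv w k = i.+1 -> w i.+1 = k by move <-; rewrite splus_invK.
rewrite !swapn_lt ?dw ?andbT // => -[].
- by move=> /pi1 h1 /qi2 h2; apply: nak.
- by move=> /qi1 h1 /pi2 h2; move: dw; rewrite h1 h2; lia.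
- by move=> h1 h2; apply: nak.
- by move=> h1 h2; move: dw; rewrite h1 h2; lia.
Qed.

Lemma fixes_leq m n w : (m <= n)%N -> fixes m w -> fixes n w.
Proof. by move=> mn h k /(leq_trans mn) /h. Qed.

Lemma fixes_lt n w k : fixes n w -> (k < n)%N -> (w k < n)%N.
Proof.
move=> h kn; rewrite ltnNge; apply/negP => nw; have := h _ nw.
by move/(can_inj (@splus_funK w)); lia.
Qed.

Lemma fixes_inv n w : fixes n w -> fixes n w^-1%g.
Proof. by move=> h k /h {1}<-; rewrite splus_invE splus_funK. Qed.

Lemma fixes_seq (s : seq splus) : exists n, forall w, w \in s -> fixes n w.
Proof.
elim: s => [|u s [n hn]]; first by exists 0%N.
case: (splus_fin u) => m hm; exists (maxn m n) => w.
rewrite inE => /orP[/eqP->|].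
  exact: fixes_leq (leq_maxl _ _) hm.
by move/hn; apply: fixes_leq (leq_maxr _ _).
Qed.

Lemma fixes_rdesc n i w : fixes n w -> rdesc i w -> (i.+1 < n)%N.
Proof.
rewrite /rdesc => h d; rewrite ltnNge; apply/negP => ni.
have := h _ ni; case: (ltnP i n) => [/(fixes_lt h)|/h]; lia.
Qed.

Lemma fixes_ldesc n k w : fixes n w -> ldesc k w -> (k.+1 < n)%N.
Proof. by move=> /fixes_inv; apply: fixes_rdesc. Qed.

Lemma fixes_sgen n i w : (i.+1 < n)%N -> fixes n w -> fixes n (w * sgen i)%g.
Proof.
by move=> lin h k nk; rewrite splusM /= /swapn !gtn_eqF ?h //; lia.
Qed.

(** An increasing permutation satisfies k <= w k, and once the inequality is
strict it stays so, which contradicts finite support. *)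
Lemma no_rdesc_id n w : fixes n w ->
  (forall i, (i.+1 < n)%N -> ~~ rdesc i w) -> w = 1%g.
Proof.
move=> h nd; have up i : (w i < w i.+1)%N.
  have : ~~ rdesc i w.
    case: (ltnP i.+1 n) => [/nd//|ni].
    by apply/negP => /(fixes_rdesc h); lia.
  rewrite -leqNgt leq_eqVlt => /orP[/eqP/(can_inj (@splus_funK w))|//]; lia.
have geq k : (k <= w k)%N by elim: k => [//|k IH]; apply: leq_ltn_trans (up k).
apply: splusP => k; apply/eqP; rewrite eqn_leq geq andbT leqNgt; apply/negP => lt.
have gt d : (k + d < w (k + d))%N.
  by elim: d => [|d IH]; rewrite ?addn0 // addnS; apply: leq_ltn_trans (up _).
by have := gt n; rewrite h ?leq_addl // ltnn.
Qed.

Lemma w0_fixes n : fixes n (w0 n).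
Proof. by move=> k nk; rewrite /= /revn ltnNge nk. Qed.

(** This reduces to [no_rdesc_id] because w * w_0 has no descents. *)
Lemma all_rdesc_w0 n w : fixes n w ->
  (forall i, (i.+1 < n)%N -> rdesc i w) -> w = w0 n.
Proof.
move=> h d; have: (w * w0 n)%g = 1%g.
  apply: (@no_rdesc_id n) => [k nk|i lin].
    by rewrite splusM w0_fixes // h.
  rewrite -leqNgt !splusM /= /revn lin (ltnW lin).
  have := d (n.-1 - i.+1)%N; rewrite /rdesc.
  have -> : (n.-1 - i.+1).+1 = (n.-1 - i)%N by lia.
  by move=> /(_ _)/ltnW; apply; lia.
move=> e.
have -> : w = (w * w0 n * w0 n)%g.
  by apply: splusP => k; rewrite !splusM /= revnK.
by rewrite e; apply: splusP.
Qed.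

Lemma bigD1_adj (R : Type) (idx : R) (op : Monoid.com_law idx) n i
    (F : nat -> R) : (i.+1 < n)%N ->
  \big[op/idx]_(k < n) F k =
  op (F i) (op (F i.+1)
    (\big[op/idx]_(k < n | (k != i :> nat) && (k != i.+1 :> nat)) F k)).
Proof.
move=> lin; pose a := Ordinal (ltnW lin); pose b := Ordinal lin.
have ba : b != a by rewrite -val_eqE /= gtn_eqF.
by rewrite (bigD1 a) //= (bigD1 b).
Qed.

(** A substitute for the Coxeter length: by the rearrangement inequality it
decreases when a descent is removed, and unlike an inversion count it changes in
two terms only. *)
Definition weight (n : nat) (w : splus) : nat := (\sum_(k < n) (n - k) * w k)%N.

Lemma weight_rdesc n i w : (i.+1 < n)%N -> rdesc i w ->
  (weight n (w * sgen i)%g < weight n w)%N.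
Proof.
rewrite /weight /rdesc => lin d.
rewrite (bigD1_adj _ (fun k => (n - k) * (w * sgen i)%g k)%N lin).
rewrite (bigD1_adj _ (fun k => (n - k) * w k)%N lin) /=.
rewrite {1 2}/swapn eqxx gtn_eqF // eqxx.
rewrite (eq_bigr (fun k : 'I_n => (n - k) * w k)%N); last first.
  by move=> k /andP[ki ki1]; rewrite /swapn !ifN.
rewrite !addnA ltn_add2r.
have -> : (n - i = (n - i.+1).+1)%N by lia.
by rewrite !mulSn; lia.
Qed.

Lemma weight_le n w : fixes n w -> (weight n w <= n * (n * n))%N.
Proof.
move=> h; rewrite /weight -[leqRHS](_ : \sum_(k < n) (n * n) = _)%N.
  by apply: leq_sum => k _; apply: leq_mul; rewrite ?leq_subr // ltnW ?fixes_lt.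
by rewrite sum_nat_const card_ord.
Qed.

(** Every permutation of {0, ..., n - 1} is reached from the longest one by
removing descents: a permutation other than w_0 has an ascent, and filling it
increases the bounded quantity [weight]. *)
Lemma w0_descending_ind n (P : splus -> Prop) : P (w0 n) ->
  (forall w i, fixes n w -> rdesc i w -> P w -> P (w * sgen i)%g) ->
  forall w, fixes n w -> P w.
Proof.
move=> P0 Pd w; have [N] := ubnP (n * (n * n) - weight n w)%N.
elim: N w => // N IH w lt h.
have [d|] := pselect (forall i, (i.+1 < n)%N -> rdesc i w).
  by rewrite (all_rdesc_w0 h d).
move=> /existsNP[i /not_implyP[lin /negP nd]].
have d : rdesc i (w * sgen i)%g by rewrite rdesc_sgen.
have h' := fixes_sgen lin h.
rewrite -(mulgsgenK i w); apply: Pd => //; apply: IH => //.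
have := weight_rdesc lin d; rewrite mulgsgenK.
have := weight_le h'; lia.
Qed.

(** * Derivations of commutative rings *)

Section Derivation.
Variables (R : comNzRingType) (d : R -> R).
Hypothesis dM : forall x y, d (x * y) = d x * y + x * d y.

Lemma derivation1 : d 1 = 0.
Proof. by apply: (@addrI _ (d 1)); rewrite addr0 -{3}(mulr1 1) dM mulr1 mul1r. Qed.

Lemma derivationX x n : d (x ^+ n) = d x * x ^+ n.-1 *+ n.
Proof.
elim: n => [|n IH]; first by rewrite expr0 mulr0n derivation1.
rewrite exprS dM IH /= mulrnAr mulrCA [RHS]mulrS; congr (_ + _).
by case: n {IH} => [|n] //=; rewrite -exprS.
Qed.

Lemma derivation_prod n (F : nat -> R) :
  d (\prod_(j < n) F j) =
  \sum_(i < n) \prod_(j < n) (if j == i :> nat then d (F j) else F j).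
Proof.
elim: n => [|n IH]; first by rewrite !big_ord0 derivation1.
rewrite big_ord_recr dM IH [RHS]big_ord_recr /= mulr_suml; congr (_ + _).
  apply: eq_bigr => i _; rewrite big_ord_recr /=.
  by rewrite [n == i]gtn_eqF.
rewrite big_ord_recr /= eqxx; congr (_ * _).
by apply: eq_bigr => j _; rewrite ltn_eqF.
Qed.
End Derivation.

(** * The staircase monomial *)

(** The divided difference at i of the staircase monomial lowers the exponent of
x_i by one: the exponents of x_i and x_(i+1) are e + 1 and e, and the other
factors are fixed by s_i.  Stated for an abstract ring and an endomorphism s that
acts on the variables as s_i. *)
Lemma staircase_ddiff (R : comNzRingType) (x : nat -> R)
    (s : {rmorphism R -> R}) n i :
  (forall j, s (x j) = x (swapn i i.+1 j)) -> (i.+1 < n)%N ->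
  (x i - x i.+1) * \prod_(j < n) (if j == i :> nat then x j ^+ (n.-1 - j).-1
                                  else x j ^+ (n.-1 - j)) =
  \prod_(j < n) x j ^+ (n.-1 - j) - s (\prod_(j < n) x j ^+ (n.-1 - j)).
Proof.
move=> sx lin; pose Q := \prod_(k < n | (k != i :> nat) && (k != i.+1 :> nat))
  x k ^+ (n.-1 - k).
pose e := (n.-1 - i.+1)%N; have ie : (n.-1 - i = e.+1)%N by rewrite /e; lia.
have QE : s Q = Q.
  rewrite rmorph_prod; apply: eq_bigr => k /andP[/negPf ki /negPf ki1].
  by rewrite rmorphXn sx /swapn ki ki1.
rewrite (bigD1_adj _ (fun j => if j == i :> nat then x j ^+ (n.-1 - j).-1
    else x j ^+ (n.-1 - j)) lin).
rewrite (bigD1_adj _ (fun j => x j ^+ (n.-1 - j)) lin) -/e -/Q.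
rewrite (eq_bigr (fun k : 'I_n => x k ^+ (n.-1 - k))); last first.
  by move=> k /andP[/negPf-> _].
rewrite -/Q eqxx ie gtn_eqF // !rmorphM QE !rmorphXn !sx /swapn eqxx gtn_eqF //.
by rewrite eqxx !exprS /=; ring.
Qed.

(** Lowering the exponent m - j of x_j contributes the factor m - j; the terms are
indexed by k = m - j - 1, which is the index for which s_k w_0 = w_0 s_j.  The
last variable has exponent 0 and contributes nothing. *)
Lemma staircase_derivation (R : comNzRingType) (x : nat -> R) (d : R -> R) m :
  (forall a b, d (a * b) = d a * b + a * d b) -> (forall i, d (x i) = 1) ->
  d (\prod_(j < m.+1) x j ^+ (m - j)) =
  \sum_(k < m) (\prod_(j < m.+1)
    (if j == (m - k.+1)%N :> nat then x j ^+ (m - j).-1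
     else x j ^+ (m - j))) *+ k.+1.
Proof.
move=> dM dx; rewrite (derivation_prod dM m.+1 (fun j => x j ^+ (m - j))).
rewrite big_ord_recr /= [X in _ + X]big_ord_recr /= eqxx subnn expr0.
rewrite (derivation1 dM) mulr0 addr0.
rewrite (reindex_inj rev_ord_inj) /=; apply: eq_bigr => k _.
have Em : (m - (m - k.+1) = k.+1)%N by have := ltn_ord k; lia.
have im : (m - k.+1 < m.+1)%N by lia.
move: (m - k.+1)%N Em im => i Em im.
rewrite (bigD1 (Ordinal im)) //= eqxx [in RHS](bigD1 (Ordinal im)) //= eqxx.
rewrite (derivationX dM) dx mul1r Em mulrnAl; congr (_ * _ *+ _).
by apply: eq_bigr => j; rewrite -val_eqE /= => /negPf->.
Qed.

(** * Evaluation of polynomials and the derivation nabla *)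

Section MonomialEvaluation.
Variables (R : comNzRingType) (v : nat -> R).

Definition cm_eval (m : {cmonom nat}) : R :=
  \prod_(i <- finsupp m) v i ^+ m i.

Lemma cm_evalEw (m : {cmonom nat}) (d : {fset nat}) :
  (finsupp m `<=` d)%fset -> cm_eval m = \prod_(i <- d) v i ^+ m i.
Proof.
move=> md; rewrite /cm_eval (big_fset_incl _ md) //= => i _.
by rewrite -cmE_eq0 => /eqP->.
Qed.

Lemma cm_eval_mmorphism : mmorphism cm_eval.
Proof.
split=> [m1 m2|]; last by rewrite /cm_eval mdom1 big_seq_fset0.
pose d := (finsupp m1 `|` finsupp m2)%fset.
rewrite !(@cm_evalEw _ d) ?mdomD ?fsubsetUl ?fsubsetUr // -big_split /=.
by apply: eq_bigr => i _; rewrite cmM exprD.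
Qed.

HB.instance Definition _ :=
  isMultiplicative.Build {cmonom nat} R cm_eval cm_eval_mmorphism.

Definition zeval : zpoly -> R := mmap (intmul 1) cm_eval.
HB.instance Definition _ := GRing.RMorphism.on zeval.

Lemma cm_evalU i : cm_eval (ucm i) = v i.
Proof. by rewrite /cm_eval mdomU big_seq_fset1 cmUU expr1. Qed.

Lemma zevalX i : zeval 'x_i = v i.
Proof. by rewrite /zeval /xvar mmapU mul1r cm_evalU. Qed.
End MonomialEvaluation.

Lemma malgCz (c : int) : c%:MP = c%:~R :> zpoly.
Proof. by rewrite -[c in LHS]intz rmorph_int. Qed.

Lemma malgUU (a b : {cmonom nat}) : << a >> * << b >> = << mmul a b >> :> zpoly.
Proof. by rewrite malgM_def fgmulUU mulr1. Qed.

Lemma monomE (m : {cmonom nat}) : cm_eval xvar m = << m >>.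
Proof.
have powE i n : 'x_i ^+ n = << iter n (mmul (ucm i)) mone >>.
  elim: n => [|n IH]; first by rewrite expr0 -mpolyC1E.
  by rewrite exprS IH /xvar malgUU iterS; congr (mkmalgU _ _).
rewrite /cm_eval (eq_bigr (fun i => << iter (m i) (mmul (ucm i)) mone >>));
  last by move=> i _; rewrite powE.
have <- := @big_morph zpoly {cmonom nat} (fun k => << k >>) 1 *%R
   mone (@mmul _) (fun a b => esym (malgUU a b)) (mpolyC1E _ _).
congr << _ >>; apply/eqP/cmP => j.
have -> : forall s (F : nat -> {cmonom nat}),
    (\big[@mmul _/mone]_(i <- s) F i) j = (\sum_(i <- s) F i j)%N.
  by move=> s F; elim/big_rec2: _ => [|i a b _ <-]; rewrite ?cm1 ?cmM.
have itE i n : (iter n (mmul (ucm i)) mone : {cmonom nat}) j = (n * (i == j))%N.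
  by elim: n => [|n IH]; rewrite ?cm1 //= cmM cmU IH mulSn.
under eq_bigr do rewrite itE.
case: (boolP (j \in finsupp m)) => jm.
  rewrite (big_fsetD1 _ jm) /= eqxx muln1 big1_seq ?addn0 // => i.
  by rewrite !inE => /andP[_ /andP[/negPf-> _]]; rewrite muln0.
rewrite big1_seq; first by move: jm; rewrite -cmE_eq0 => /eqP.
by move=> i /= im; case: eqP im jm => [->->//|_ _ _]; rewrite muln0.
Qed.

(** The universal property of the polynomial ring: a ring morphism is determined
by the images of the variables. *)
Lemma rmorph_zeval (R : comNzRingType) (f : {rmorphism zpoly -> R}) p :
  f p = zeval (fun i => f 'x_i) p.
Proof.
rewrite /zeval mmapE [in LHS](monalgE p) rmorph_sum; apply: eq_bigr => m _.
have -> : << p@_m *g m >> = (p@_m)%:~R * cm_eval xvar m.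
  by rewrite monomE -malgCz malgM_def fgmulUU mulr1 mul1m.
rewrite rmorphM rmorph_int; congr (_ * _); rewrite rmorph_prod.
by apply: eq_bigr => i _; rewrite rmorphXn.
Qed.

Lemma pact_zeval u : pact u =1 zeval (fun i => 'x_(u i)).
Proof.
by move=> p; rewrite /pact /zeval !mmapE; apply: eq_bigr => m _; rewrite malgCz.
Qed.

Lemma zpoly_morph_ext (R : comNzRingType) (f g : {rmorphism zpoly -> R}) :
  (forall i, f 'x_i = g 'x_i) -> f =1 g.
Proof. by move=> /funext fg p; rewrite rmorph_zeval fg -rmorph_zeval. Qed.

Lemma pact_rmorphism u : zmod_morphism (pact u) * monoid_morphism (pact u).
Proof.
split=> [p q|]; first by rewrite !pact_zeval rmorphB.
by split=> [|p q]; rewrite !pact_zeval ?rmorph1 ?rmorphM.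
Qed.
HB.instance Definition _ u :=
  GRing.isZmodMorphism.Build zpoly zpoly (pact u) (pact_rmorphism u).1.
HB.instance Definition _ u :=
  GRing.isMonoidMorphism.Build zpoly zpoly (pact u) (pact_rmorphism u).2.

Lemma pactX u i : pact u 'x_i = 'x_(u i).
Proof. by rewrite pact_zeval zevalX. Qed.

Lemma pact_sgenK i : involutive (pact (sgen i)).
Proof.
apply: (@zpoly_morph_ext _ (pact (sgen i) \o pact (sgen i)) idfun) => j /=.
by rewrite !pactX /= swapnK.
Qed.

(** The Taylor expansion p(x_1 + T, x_2 + T, ...).  Its coefficient in T is the sum
of the partial derivatives of p; this encoding derives the Leibniz rule from the
multiplicativity of evaluation. *)
Definition shift : zpoly -> {poly zpoly} := zeval (fun i => ('x_i)%:P + 'X).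
HB.instance Definition _ := GRing.RMorphism.on shift.

Definition nabla (p : zpoly) : zpoly := (shift p)`_1.

Lemma shiftX i : shift 'x_i = ('x_i)%:P + 'X.
Proof. exact: zevalX. Qed.

Lemma shift0 p : (shift p)`_0 = p.
Proof.
rewrite -horner_coef0 -[RHS]/(idfun p).
rewrite -[LHS]/((horner_eval 0 \o shift) p).
apply: zpoly_morph_ext => i /=.
by rewrite shiftX /horner_eval !hornerE.
Qed.

Lemma nabla_is_additive : zmod_morphism nabla.
Proof. by move=> p q; rewrite /nabla rmorphB coefB. Qed.
HB.instance Definition _ :=
  GRing.isZmodMorphism.Build zpoly zpoly nabla nabla_is_additive.

Lemma coef1M (R : nzRingType) (p q : {poly R}) :
  (p * q)`_1 = p`_1 * q`_0 + p`_0 * q`_1.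
Proof. by rewrite coefM big_ord_recr big_ord1 /= addrC. Qed.

Lemma nablaM p q : nabla (p * q) = nabla p * q + p * nabla q.
Proof.
by rewrite /nabla (rmorphM shift) coef1M !shift0.
Qed.

Lemma nablaX i : nabla 'x_i = 1.
Proof. by rewrite /nabla shiftX coefD coefC coefX add0r. Qed.

(** Both sides are coefficients in T of ring morphisms that send x_i to
x_(u i) + T. *)
Lemma nabla_pact u p : nabla (pact u p) = pact u (nabla p).
Proof.
suff e : shift (pact u p) = map_poly (pact u) (shift p).
  by rewrite /nabla e coef_map.
rewrite -[LHS]/((shift \o pact u) p) -[RHS]/((map_poly (pact u) \o shift) p).
apply: zpoly_morph_ext => i /=.
rewrite pactX [LHS]shiftX [in RHS]shiftX rmorphD /= map_polyC map_polyX /=.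
by rewrite pactX.
Qed.

(** If x_a q = x_b q, comparing the coefficients of x_a m gives q_m = 0 when x_b
does not divide m, and q_m = q_(x_a m / x_b) otherwise; the exponent of x_b
decreases, so all coefficients vanish.  This is what makes divided differences
unique. *)
Lemma xvar_regular a b q : a != b -> ('x_a - 'x_b) * q = 0 -> q = 0.
Proof.
move=> ab; rewrite mulrBl => /eqP; rewrite subr_eq0 => /eqP e.
have mulX i m : ('x_i * q)@_m = if m i == 0%N then 0 else q@_(divcm m (ucm i)).
  rewrite malgM_def fgmulUg raddf_sum /=.
  case: ifP => [/eqP mi|/negbT mi].
    apply: big1 => k _; rewrite mcoeffU.
    case: eqP => [km|_]; last by rewrite mulr0n.
    by move: mi; rewrite -km cmM cmU eqxx.
  move: mi; rewrite -lt0n => mi.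
  transitivity (\sum_(k <- msupp q) << q@_k *g k >>@_(divcm m (ucm i))).
    apply: eq_bigr => k _; rewrite mul1r !mcoeffU; congr (_ *+ nat_of_bool _).
    apply/eqP/eqP => [<-|->]; apply/eqP/cmP => j.
      by rewrite divcmE cmM addKn.
    rewrite cmM divcmE cmU; case: eqP => [<-|_]; last by rewrite subn0.
    exact: subnKC.
  by rewrite -raddf_sum -monalgE.
apply/malgP => m; rewrite mcoeff0.
have [N mN] := ubnP (m b).
elim: N m mN => [|N IH] m mN; first by rewrite ltn0 in mN.
have := mulX a (mmul m (ucm a)); rewrite e (mulX b).
have -> : divcm (mmul m (ucm a)) (ucm a) = m.
  by apply/eqP/cmP => j; rewrite divcmE cmM addnK.
rewrite !cmM !cmU eqxx addn1 (negPf ab) addn0.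
rewrite -[RHS]/(q@_m) => <-.
case: ifP => [//|/negbT mb]; apply: IH.
rewrite divcmE !cmM !cmU eqxx (negPf ab) addn0.
by rewrite -lt0n in mb; lia.
Qed.

(** * Divided differences *)

(** A relation rather than a function: the quotient by x_i - x_(i+1) is unique
([ddiff_uniq]), and for Schubert polynomials it is given by the family itself
([ddiff_schubert]). *)
Definition ddiff (i : nat) (p q : zpoly) : Prop :=
  ('x_i - 'x_i.+1) * q = p - pact (sgen i) p.

Lemma ddiff_uniq i p q q' : ddiff i p q -> ddiff i p q' -> q = q'.
Proof.
rewrite /ddiff => <- e; apply/eqP; rewrite -subr_eq0; apply/eqP.
apply: (@xvar_regular i i.+1); first by rewrite ltn_eqF.
by rewrite mulrBr e subrr.
Qed.

Lemma ddiff0 i : ddiff i 0 0.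
Proof. by rewrite /ddiff mulr0 raddf0 subr0. Qed.

Lemma ddiffD i p q p' q' :
  ddiff i p q -> ddiff i p' q' -> ddiff i (p + p') (q + q').
Proof. by rewrite /ddiff mulrDr raddfD opprD addrACA => -> ->. Qed.

Lemma ddiff_sum i (I : Type) (r : seq I) (P : pred I) (p q : I -> zpoly) :
  (forall j, P j -> ddiff i (p j) (q j)) ->
  ddiff i (\sum_(j <- r | P j) p j) (\sum_(j <- r | P j) q j).
Proof.
move=> h; apply: (big_rec2 (ddiff i)) => [|j y1 y2 /h]; first exact: ddiff0.
exact: ddiffD.
Qed.

Lemma zscaleE (c : int) (p : zpoly) : c *: p = p *~ c.
Proof. by rewrite -[c in LHS]intz scaler_int. Qed.

Lemma ddiffZ i (c : int) p q : ddiff i p q -> ddiff i (c *: p) (c *: q).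
Proof.
rewrite /ddiff !zscaleE => h.
by rewrite mulrzAr h (raddfMz (pact (sgen i))) mulrzBl.
Qed.

Lemma ddiffMn i n p q : ddiff i p q -> ddiff i (p *+ n) (q *+ n).
Proof.
rewrite /ddiff => h.
by rewrite mulrnAr h (raddfMn (pact (sgen i))) mulrnBl.
Qed.

(** The derivation kills x_i - x_(i+1), so it commutes with the defining equation of
a divided difference. *)
Lemma ddiff_nabla i p q : ddiff i p q -> ddiff i (nabla p) (nabla q).
Proof.
move=> e.
have nx : nabla ('x_i - 'x_i.+1) = 0.
  by rewrite -[RHS](subrr 1) raddfB; congr (_ - _); exact: nablaX.
move/(congr1 nabla): e; rewrite nablaM nx mul0r add0r /ddiff => ->.
by rewrite raddfB; congr (_ - _); exact: nabla_pact.
Qed.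

Lemma pact_sgen_xvar i :
  pact (sgen i) 'x_i = 'x_i.+1 /\ pact (sgen i) 'x_i.+1 = 'x_i.
Proof.
by split; rewrite pactX; congr xvar; rewrite /= /swapn eqxx ?gtn_eqF.
Qed.

Lemma pact_sgen_alt i : pact (sgen i) ('x_i - 'x_i.+1) = - ('x_i - 'x_i.+1).
Proof.
rewrite raddfB opprB; have [e1 e2] := pact_sgen_xvar i.
by congr (_ - _); [exact: e1 | exact: e2].
Qed.

(** A divided difference is symmetric in x_i and x_(i+1), since its numerator and its
denominator are both antisymmetric; hence its own divided difference is 0. *)
Lemma ddiff_ddiff0 i p q : ddiff i p q -> ddiff i q 0.
Proof.
rewrite /ddiff mulr0 => e; apply/esym.
apply: (@xvar_regular i i.+1); first by rewrite ltn_eqF.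
rewrite mulrBr e.
have := congr1 (pact (sgen i)) e.
have -> : pact (sgen i) (('x_i - 'x_i.+1) * q) =
    - (('x_i - 'x_i.+1) * pact (sgen i) q).
  rewrite rmorphM -mulNr; congr (_ * _); exact: pact_sgen_alt.
move=> /(congr1 -%R); rewrite opprK => ->.
by rewrite raddfB /= pact_sgenK opprB subrr.
Qed.

(** * Schubert polynomials *)

Section SchubertFamily.
Variables (Sch : splus -> zpoly) (hS : schubert_family Sch).

(** If w has no descent at i, then S_w is itself the divided difference of
S_(w s_i), so [ddiff_ddiff0] applies. *)
Lemma ddiff_schubert i w :
  ddiff i (Sch w) (if rdesc i w then Sch (w * sgen i)%g else 0).
Proof.
have down x : rdesc i x -> ddiff i (Sch x) (Sch (x * sgen i)%g).
  by move=> /rdescP d; exact: hS.2.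
case: ifP => [/down//|/negbT d].
apply: (@ddiff_ddiff0 _ (Sch (w * sgen i)%g)).
by rewrite -{2}(mulgsgenK i w); apply: down; rewrite rdesc_sgen.
Qed.

Lemma schubert_id : Sch 1%g = 1.
Proof. by have := hS.1 0%N; rewrite big_ord0 => <-; congr Sch; apply: splusP. Qed.

Lemma schubert_w0_sgen n i : (i.+1 < n)%N ->
  Sch (w0 n * sgen i)%g =
  \prod_(j < n) (if j == i :> nat then 'x_j ^+ (n.-1 - j).-1
                 else 'x_j ^+ (n.-1 - j)).
Proof.
move=> lin; have d : rdesc i (w0 n).
  by rewrite /rdesc /= /revn; do ![case: ifP]; lia.
apply: (ddiff_uniq (i := i) (p := Sch (w0 n))).
  by have := ddiff_schubert i (w0 n); rewrite d.
rewrite /ddiff hS.1.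
by apply: (staircase_ddiff (x := xvar) (s := pact (sgen i))) => // k; exact: pactX.
Qed.

Lemma sgen_w0 m k : (k < m)%N ->
  (sgen k * w0 m.+1)%g = (w0 m.+1 * sgen (m - k.+1))%g.
Proof.
move=> km; apply: splusP => j; rewrite !splusM /= /swapn /revn /=.
by do ![case: ifP]; lia.
Qed.

Lemma ldesc_w0 n k : ldesc k (w0 n) = (k.+1 < n)%N.
Proof.
rewrite /ldesc !splus_invE /= /revn.
by do ![case: ifP]; lia.
Qed.

(** The bound n only makes the sum finite: a permutation fixing all k >= n has its
left descents below n. *)
Definition nabla_formula (n : nat) (w : splus) : Prop :=
  nabla (Sch w) = \sum_(k < n | ldesc k w) Sch (sgen k * w)%g *+ k.+1.

Lemma nabla_schubert_w0 n : nabla_formula n (w0 n).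
Proof.
rewrite /nabla_formula hS.1.
under [RHS]eq_bigl do rewrite ldesc_w0.
case: n => [|m].
  by rewrite !big_ord0; exact: derivation1 nablaM.
rewrite [LHS](staircase_derivation m nablaM nablaX).
rewrite [RHS]big_mkcond big_ord_recr /= ltnn addr0.
apply: eq_bigr => k _; rewrite ltnS ltn_ord sgen_w0 // schubert_w0_sgen //.
by have := ltn_ord k; lia.
Qed.

(** The inductive step applies the divided difference at i to the formula for w.  It
sends nabla S_w to nabla S_(w s_i), and S_(s_k w) to S_(s_k w s_i) or 0 according
to whether s_k w has a descent at i; [ldesc_rdesc] identifies the k that
survive. *)
Lemma nabla_schubert n w : fixes n w -> nabla_formula n w.
Proof.
apply: w0_descending_ind => [|{}w i h d IH]; first exact: nabla_schubert_w0.
rewrite /nabla_formula.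
have e : ddiff i (Sch w) (Sch (w * sgen i)%g).
  by have := ddiff_schubert i w; rewrite d.
apply: (ddiff_uniq (ddiff_nabla e)); rewrite IH.
under [X in ddiff _ _ X]eq_bigl do rewrite -(ldesc_rdesc _ d).
rewrite big_mkcondr /=; apply: ddiff_sum => k _.
rewrite -mulrb mulrnAC; apply: ddiffMn.
have := ddiff_schubert i (sgen k * w)%g; rewrite -mulrb.
by rewrite -[(_ * _ * sgen i)%g]mulgA.
Qed.

(** Taking the divided difference of a linear relation gives a relation between
permutations of smaller weight, whose coefficients are those a x with x having a
descent at i.  By induction they vanish; the only permutation without descents is
the identity, and S_1 = 1. *)
Lemma schubert_free_weight n N (s : seq splus) (a : splus -> int) : uniq s ->
  (forall w, w \in s -> fixes n w /\ (weight n w < N)%N) ->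
  \sum_(w <- s) a w *: Sch w = 0 -> forall w, w \in s -> a w = 0.
Proof.
elim: N s a => [|N IH] s a us hs es w ws; first by case: (hs w ws).
have desc0 i x : x \in s -> rdesc i x -> a x = 0.
  move=> xs dx; pose t := [seq (y * sgen i)%g | y <- s & rdesc i y].
  have e0 : \sum_(y <- s)
      a y *: (if rdesc i y then Sch (y * sgen i)%g else 0) = 0.
    apply: (@ddiff_uniq i 0); last exact: ddiff0.
    rewrite -[X in ddiff _ X]es.
    by apply: ddiff_sum => y _; apply/ddiffZ/ddiff_schubert.
  rewrite -(mulgsgenK i x).
  apply: (IH t (fun y => a (y * sgen i)%g) _ _ _ (x * sgen i)%g).
  - rewrite map_inj_uniq ?filter_uniq // => y z yz.
    by rewrite -(mulgsgenK i y) yz mulgsgenK.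
  - move=> y /mapP[z]; rewrite mem_filter => /andP[dz zs] ->.
    have [fz wz] := hs _ zs; have lin := fixes_rdesc fz dz.
    split; first exact: fixes_sgen.
    by have := weight_rdesc lin dz; lia.
  - rewrite big_map big_filter big_mkcond -[RHS]e0.
    apply: eq_bigr => y _.
    by rewrite mulgsgenK; case: ifP => // _; rewrite scaler0.
  - by apply: map_f; rewrite mem_filter dx.
have [[i dw]|nd] := pselect (exists i, rdesc i w); first exact: desc0 dw.
have w1 : w = 1%g.
  by apply: no_rdesc_id (hs w ws).1 _ => i _; apply/negP => d; apply: nd; exists i.
move: es; rewrite (bigD1_seq w) //= big1_seq ?addr0 => [|x /andP[xw xs]].
  rewrite w1 schubert_id => /(congr1 (mcoeff mone)).
  by rewrite mcoeffZ mcoeff1 eqxx mulr1 mcoeff0.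
have [[i dx]|nx] := pselect (exists i, rdesc i x).
  by rewrite (desc0 i x) // scale0r.
case/eqP: xw; rewrite w1.
by apply: no_rdesc_id (hs x xs).1 _ => i _; apply/negP => d; apply: nx; exists i.
Qed.
End SchubertFamily.

Lemma schubert_free Sch (s : seq splus) (a : splus -> int) :
  schubert_family Sch -> uniq s ->
  \sum_(x <- s) a x *: Sch x = 0 -> forall x, x \in s -> a x = 0.
Proof.
move=> hS us; have [n fn] := fixes_seq s.
apply: (schubert_free_weight hS (n := n) (N := (n * (n * n)).+1) us) => x /fn fx.
by split=> //; rewrite ltnS weight_le.
Qed.

(** * Expansions in a family of vectors *)

Section Expansion.
Variables (V : lmodType int) (T : choiceType) (e : T -> V).

(** The elements of the list s may have coefficient 0, so that two expansions can be
brought to a common list. *)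
Definition expands (p : V) (a : T -> int) : Prop :=
  exists s : seq T, [/\ uniq s, forall x, x \notin s -> a x = 0
                     & p = \sum_(x <- s) a x *: e x].

Lemma fsumT (M : nmodType) (s : seq T) (f : T -> M) : uniq s ->
  (forall x, x \notin s -> f x = 0) ->
  \sum_(x \in [set: T]) f x = \sum_(x <- s) f x.
Proof.
move=> us fs; rewrite (fsbigE s) // => [|x _]; last exact: fs.
by apply: eq_bigl => x; rewrite in_setT.
Qed.

Lemma expands_fsum p a : finite_set [set x | a x != 0] ->
  p = \sum_(x \in [set: T]) a x *: e x -> expands p a.
Proof.
move=> fa ->; exists (fset_set [set x | a x != 0]).
have a0 x : x \notin fset_set [set x | a x != 0] -> a x = 0.
  rewrite in_fset_set // => /negP xa.
  by apply/eqP/negPn/negP => ax; apply: xa; rewrite inE.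
by split=> //; apply: fsumT => [|x /a0->]; rewrite ?fset_uniq ?scale0r.
Qed.

Lemma expands_widen p a : expands p a -> exists s : seq T,
  forall t, uniq t -> {subset s <= t} ->
  (forall x, x \notin t -> a x = 0) /\ p = \sum_(x <- t) a x *: e x.
Proof.
case=> s [us as0 ->]; exists s => t ut st.
have at0 x : x \notin t -> a x = 0.
  by move=> xt; apply: as0; apply: contra xt => /st.
split=> //; transitivity (\sum_(x \in [set: T]) a x *: e x).
  by apply/esym/fsumT => // x /as0->; rewrite scale0r.
by apply: fsumT => // x /at0->; rewrite scale0r.
Qed.

Lemma expands_pair p a q b : expands p a -> expands q b -> exists t : seq T,
  [/\ uniq t, forall x, x \notin t -> a x = 0, forall x, x \notin t -> b x = 0,
      p = \sum_(x <- t) a x *: e x & q = \sum_(x <- t) b x *: e x].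
Proof.
move=> /expands_widen[s hs] /expands_widen[r hr].
exists (undup (s ++ r)).
have [||? ?] := hs (undup (s ++ r)); first exact: undup_uniq.
  by move=> x xs; rewrite mem_undup mem_cat xs.
have [||? ?] := hr (undup (s ++ r)); first exact: undup_uniq.
  by move=> x xr; rewrite mem_undup mem_cat xr orbT.
by split=> //; apply: undup_uniq.
Qed.

Lemma expands0 : expands 0 (fun=> 0).
Proof. by exists [::]; rewrite big_nil. Qed.

Lemma expandsD p a q b : expands p a -> expands q b ->
  expands (p + q) (fun x => a x + b x).
Proof.
move=> pa qb; have [t [ut at0 bt0 -> ->]] := expands_pair pa qb.
exists t; split=> // [x xt|]; first by rewrite at0 ?bt0 ?addr0.
by rewrite -big_split; apply: eq_bigr => x _; rewrite scalerDl.
Qed.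

Lemma expandsMn p a n : expands p a -> expands (p *+ n) (fun x => a x *+ n).
Proof.
move=> [s [us as0 ->]]; exists s; split=> // [x /as0->|]; first by rewrite mul0rn.
by rewrite -sumrMnl; apply: eq_bigr => x _; rewrite scalerMnl.
Qed.

Lemma expands_sum n (P : pred nat) (p : nat -> V) (a : nat -> T -> int) :
  (forall i, (i < n)%N -> P i -> expands (p i) (a i)) ->
  expands (\sum_(i < n | P i) p i) (fun x => \sum_(i < n | P i) a i x).
Proof.
elim: n => [|n IH] h.
  rewrite big_ord0; under [X in expands _ X]eq_fun do rewrite big_ord0.
  exact: expands0.
rewrite big_mkcond big_ord_recr -big_mkcond /=.
under [X in expands _ X]eq_fun do
  rewrite big_mkcond big_ord_recr -big_mkcond /=.
apply: expandsD; first by apply: IH => i lin; apply: h; apply: ltnW.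
by case: ifP => Pn; [apply: h|exact: expands0].
Qed.

(** Applying the involution g to the basis vectors moves the coefficient of x to
g x. *)
Lemma expands_relabel (P : pred T) (g : T -> T) (s : seq T) (a : T -> int) :
  involutive g -> uniq s -> (forall x, x \notin s -> a x = 0) ->
  expands (\sum_(x <- s | P x) a x *: e (g x))
          (fun y => if P (g y) then a (g y) else 0).
Proof.
move=> gK us as0; exists (map g s); split.
- by rewrite map_inj_uniq //; exact: inv_inj.
- move=> y ys; case: ifP => // _; apply: as0; apply: contra ys => ys.
  by rewrite -(gK y) map_f.
- rewrite big_map big_mkcond; apply: eq_bigr => x _; rewrite gK.
  by case: ifP => // _; rewrite scale0r.
Qed.

Lemma expands_uniq p a b :
  (forall (s : seq T) (d : T -> int), uniq s ->
     \sum_(x <- s) d x *: e x = 0 -> forall x, x \in s -> d x = 0) ->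
  expands p a -> expands p b -> a =1 b.
Proof.
move=> free pa pb x; have [t [ut at0 bt0 ea eb]] := expands_pair pa pb.
have [xt|xt] := boolP (x \in t); last by rewrite at0 ?bt0.
apply/eqP; rewrite -subr_eq0; apply/eqP.
apply: (free t (fun x => a x - b x) ut _ x xt).
under eq_bigr do rewrite scalerBl.
by rewrite sumrB -ea -eb subrr.
Qed.
End Expansion.

(** Turns the sums over sets of indices in the theorem into sums over ordinals. *)
Lemma fsum_bounded (A : set nat) (P : pred nat) n (F : nat -> int) :
  (forall i, A i <-> P i) -> (forall i, P i -> (n <= i)%N -> F i = 0) ->
  \sum_(i \in A) F i = \sum_(i < n | P i) F i.
Proof.
move=> AP F0; rewrite -(big_mkord P) (bigfs _ (iota_uniq 0 (n - 0))).
  by apply: eq_fsbigl; apply/seteqP; split=> i /AP.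
by move=> i /F0 Pi; rewrite mem_iota add0n subn0 /= -leqNgt.
Qed.

(** * The identity between structure coefficients *)

Theorem proposition4p2 (Sch : splus -> zpoly)
    (c : splus -> splus -> splus -> int)
    (hS : schubert_family Sch) (hc : structure_coefs Sch c) (u v w : splus) :
  \sum_(i \in [set i : nat | (sgen i * u)%g <B u])
      i.+1%:R * c (sgen i * u)%g v w +
  \sum_(j \in [set j : nat | (sgen j * v)%g <B v])
      j.+1%:R * c u (sgen j * v)%g w =
  \sum_(k \in [set k : nat | w <B (sgen k * w)%g])
      k.+1%:R * c u v (sgen k * w)%g.
Proof.
have cE x y : expands Sch (Sch x * Sch y) (c x y).
  by have [fin e] := hc x y; exact: expands_fsum fin e.
have [s [us c0 e]] := cE u v.
(* A bound for all descents involved; for s_k w to occur with a nonzero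
   coefficient it must belong to s, so k is bounded as well. *)
have [n fn] := fixes_seq [:: u, v & s].
have fu : fixes n u by apply: fn; rewrite !inE eqxx.
have fv : fixes n v by apply: fn; rewrite !inE eqxx orbT.
have fs x : x \in s -> fixes n x by move=> xs; apply: fn; rewrite !inE xs !orbT.
(* The expansion given by the Leibniz rule. *)
have lhs : expands Sch (nabla (Sch u * Sch v)) (fun x =>
    \sum_(i < n | ldesc i u) c (sgen i * u)%g v x *+ i.+1 +
    \sum_(j < n | ldesc j v) c u (sgen j * v)%g x *+ j.+1).
  rewrite nablaM (nabla_schubert hS fu) (nabla_schubert hS fv).
  rewrite mulr_suml mulr_sumr; apply: expandsD.
    apply: (expands_sum (P := fun i => ldesc i u)
        (p := fun i => Sch (sgen i * u)%g *+ i.+1 * Sch v)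
        (a := fun i x => c (sgen i * u)%g v x *+ i.+1)) => i _ _.
    by rewrite mulrnAl; apply: expandsMn.
  apply: (expands_sum (P := fun j => ldesc j v)
      (p := fun j => Sch u * (Sch (sgen j * v)%g *+ j.+1))
      (a := fun j x => c u (sgen j * v)%g x *+ j.+1)) => j _ _.
  by rewrite mulrnAr; apply: expandsMn.
(* The expansion obtained by differentiating that of S_u * S_v term by term. *)
have rhs : expands Sch (nabla (Sch u * Sch v)) (fun x =>
    \sum_(k < n) (if ldesc k (sgen k * x)%g
                  then c u v (sgen k * x)%g else 0) *+ k.+1).
  suff -> : nabla (Sch u * Sch v) = \sum_(k < n)
      (\sum_(x <- s | ldesc k x) c u v x *: Sch (sgen k * x)%g) *+ k.+1.
    apply: (expands_sum (P := xpredT)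
        (p := fun k => (\sum_(x <- s | ldesc k x)
           c u v x *: Sch (sgen k * x)%g) *+ k.+1)
        (a := fun k x => (if ldesc k (sgen k * x)%g
           then c u v (sgen k * x)%g else 0) *+ k.+1)) => k _ _.
    by apply: expandsMn; apply: expands_relabel => //; exact: sgenK.
  rewrite e raddf_sum /=.
  transitivity (\sum_(x <- s) \sum_(k < n | ldesc k x)
      (c u v x *: Sch (sgen k * x)%g) *+ k.+1).
    apply: eq_big_seq => x /fs /(nabla_schubert hS) ex.
    rewrite zscaleE raddfMz /= ex -zscaleE scaler_sumr.
    by apply: eq_bigr => k _; rewrite scalerMnr.
  rewrite (exchange_big_dep xpredT) //=; apply: eq_bigr => k _.
  by rewrite sumrMnl.
have /= := expands_uniq (fun s a => @schubert_free Sch s a hS) lhs rhs w.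
rewrite (fsum_bounded (n := n) (fun i => ldescP i u));
  last by move=> i /(fixes_ldesc fu); lia.
rewrite (fsum_bounded (n := n) (fun j => ldescP j v));
  last by move=> j /(fixes_ldesc fv); lia.
rewrite (fsum_bounded (n := n) (fun k => ldesc_sgenP k w)); last first.
  move=> k dk nk; rewrite c0 ?mulr0 //.
  by apply/negP => /fs /fixes_ldesc /(_ dk); lia.
under eq_bigr do rewrite -mulr_natl.
under [X in _ + X]eq_bigr do rewrite -mulr_natl.
move=> ->; rewrite [RHS]big_mkcond; apply: eq_bigr => k _.
by case: ifP => _; rewrite ?mul0rn // mulr_natl.
Qed.
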